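(* Suppose that $f:\mathbb{R}^n\to\mathbb{R}$ is twice continuously differentiable and $\sigma_f$-weakly convex (i.e. $f(x)+(\sigma_f/2)\|x\|^2$ is convex), that $\nabla f$ is Lipschitz continuous with modulus $\ell_f$, and that $\nabla^2 f$ is Lipschitz continuous with modulus $L_f$. Let $\{\zeta^j\}_{j\in\mathbb{N}}$ be a sequence generated by the algorithm GSNewton for the problem $\min_{x,u}G(x,u)$, converging to a P-stationary point $\widehat\zeta=(\widehat x,\widehat u)$ with P-stationary multiplier $\widehat y$. Assume further that the strict complementarity condition holds at $(\widehat u,\widehat y)$, i.e. $\widehat u_i+\widehat y_i\ne0$ for all $i\in[m]$. Then $\{\zeta^j\}_{j\in\mathbb{N}}$ converges to $\widehat\zeta$ quadratically; namely, there exists an index $\widehat j$ such that $$\|\zeta^{j+1}-\widehat\zeta\|\le\eta\,\|\zeta^j-\widehat\zeta\|^2\qquad\text{for all } j\ge\widehat j,$$ where $\eta:=\frac{L_g}{\sigma_g}\max\{\alpha^2\ell_g^2+\eta_1^2,\ (1+\alpha\ell_g)^2+(1+\eta_1)^2\}$ and $\eta_1:=t\ell_g(1+\alpha\ell_g)$.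
   Context: $[m]=\{1,\dots,m\}$; for $T\subseteq[m]$, $\overline T:=[m]\setminus T$ and $v_T$ is the subvector of $v$ indexed by $T$. $\|u_+\|_0$ is the number of strictly positive entries of $u$, and $h(u):=\|u_+\|_0$. Given are $\lambda,\rho,\mu>0$ with $\mu>\sigma_f$, $A\in\mathbb{R}^{m\times n}$, $b,p\in\mathbb{R}^m$, $q\in\mathbb{R}^n$, and $$g(x,u):=f(x)+\langle p,Ax-u+b\rangle+\tfrac{\rho}{2}\|Ax-u+b\|^2+\tfrac{\mu}{2}\|x-q\|^2,\qquad G(x,u):=g(x,u)+\lambda\|u_+\|_0 .$$ Convention: $\sigma_g:=\mu-\sigma_f$, and $g$ is taken to be strongly convex (jointly in $(x,u)$) with modulus $\sigma_g$; $\ell_g$ and $L_g$ denote the Lipschitz moduli of $\nabla g$ and $\nabla^2 g$ respectively. For $\alpha>0$, $\mathrm{Prox}_{\alpha\lambda h(\cdot)}(v):=\arg\min_{z\in\mathbb{R}^m}\{\alpha\lambda h(z)+\tfrac12\|z-v\|^2\}$ (set-valued). $(\widehat x,\widehat u)$ is a P-stationary point of $\min G$ with P-stationary multiplier $\widehat y$ (and constant $\alpha$, here the algorithm's $\alpha$) if $\nabla_x g(\widehat x,\widehat u)=0$, $\widehat y=-\nabla_u g(\widehat x,\widehat u)$ and $\widehat u\in\mathrm{Prox}_{\alpha\lambda h(\cdot)}(\widehat u+\alpha\widehat y)$. Algorithm GSNewton: take $\alpha\in(0,1/\ell_g)$, $t\in(0,2/\ell_g)$ and a starting point $\zeta^0=(x^0,u^0)\in\mathbb{R}^n\times\mathbb{R}^m$.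 For $j=0,1,\dots$, with $\zeta^j=(x^j,u^j)$ and $y^j:=-\nabla_u g(\zeta^j)$: 1. $\Gamma_j:=\{i\in[m]: [u^j+\alpha y^j]_i\in[0,\sqrt{2\alpha\lambda})\}$. 2. $u^{j+1/2}_i:=0$ if $i\in\Gamma_j$ and $u^{j+1/2}_i:=[u^j+\alpha y^j]_i$ if $i\notin\Gamma_j$; $x^{j+1/2}:=x^j-t\nabla_x g(x^j,u^{j+1/2})$; $\zeta^{j+1/2}:=(x^{j+1/2},u^{j+1/2})$. 3. The Newton point $\widetilde\zeta^{j+1}=(\widetilde x^{j+1},\widetilde u^{j+1})$ is the solution $(x,u)$ of $u_{\Gamma_j}=0$ and $$H^{j+1/2}\begin{bmatrix}x-x^{j+1/2}\\(u-u^{j+1/2})_{\overline\Gamma_j}\end{bmatrix}=-\begin{bmatrix}\nabla_x g(\zeta^{j+1/2})\\(\nabla_u g(\zeta^{j+1/2}))_{\overline\Gamma_j}\end{bmatrix},$$ where $H^{j+1/2}$ is the Hessian of $g$ at $\zeta^{j+1/2}$ with respect to the variables $(x,u_{\overline\Gamma_j})$, i.e. it has diagonal blocks $\nabla^2f(x^{j+1/2})+\rho A^\top A+\mu I$ and $\rho I$ and off-diagonal blocks $-\rho(A_{\overline\Gamma_j})^\top$ and $-\rho A_{\overline\Gamma_j}$ ($A_T$ = rows of $A$ indexed by $T$). 4. $\zeta^{j+1}:=\widetilde\zeta^{j+1}$ if $G(\zeta^{j+1/2})-G(\widetilde\zeta^{j+1})\ge(\sigma_g/4)\|\widetilde\zeta^{j+1}-\zeta^{j+1/2}\|^2$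 (the Newton step is accepted), and $\zeta^{j+1}:=\zeta^{j+1/2}$ otherwise. *)

(* Defs.v *)
From mathcomp Require Import all_boot all_order all_algebra.
From mathcomp Require Import all_classical all_reals all_analysis.

Set Implicit Arguments.
Unset Strict Implicit.
Unset Printing Implicit Defensive.

Import Order.TTheory GRing.Theory Num.Theory.
Import numFieldNormedType.Exports.

Local Open Scope classical_set_scope.
Local Open Scope ring_scope.

Definition dotv (R : realType) (n : nat) (v w : 'cV[R]_n) : R :=
  \sum_(i < n) v i 0 * w i 0.

(* The library norm `|v| on 'cV[R]_n is the sup norm; all norm estimates below
   use the Euclidean one (topology and differentiability are unaffected). *)
Definition enorm (R : realType) (n : nat) (v : 'cV[R]_n) : R :=
  Num.sqrt (dotv v v).

Definition opnorm (R : realType) (m n : nat) (M : 'M[R]_(m, n)) : R :=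
  sup [set enorm (M *m d) | d in [set d : 'cV[R]_n | enorm d <= 1]].

Definition grad (R : realType) (n : nat) (f : 'cV[R]_n -> R) (x : 'cV[R]_n) :
    'cV[R]_n :=
  \col_i 'D_(delta_mx i 0) f x.

Definition hess (R : realType) (n : nat) (f : 'cV[R]_n -> R) (x : 'cV[R]_n) :
    'M[R]_n :=
  \matrix_(i, j) 'D_(delta_mx j 0) (fun y => grad f y i 0) x.

Definition twice_cont_diff (R : realType) (n : nat) (f : 'cV[R]_n -> R) : Prop :=
  [/\ forall x, differentiable f x,
      forall x, differentiable (grad f) x
    & continuous (hess f)].

Definition lipschitz_grad (R : realType) (n : nat) (f : 'cV[R]_n -> R) (L : R) :
    Prop :=
  0 <= L /\ forall x y, enorm (grad f x - grad f y) <= L * enorm (x - y).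

Definition lipschitz_hess (R : realType) (n : nat) (f : 'cV[R]_n -> R) (L : R) :
    Prop :=
  0 <= L /\ forall x y, opnorm (hess f x - hess f y) <= L * enorm (x - y).

Definition weakly_convex (R : realType) (n : nat) (f : 'cV[R]_n -> R)
    (sigma : R) : Prop :=
  convex_function setT (fun x => f x + sigma / 2 * enorm x ^+ 2).

Definition strongly_convex (R : realType) (n : nat) (f : 'cV[R]_n -> R)
    (sigma : R) : Prop :=
  convex_function setT (fun x => f x - sigma / 2 * enorm x ^+ 2).

(* A point (x, u) of R^n x R^m is the stacked vector z = col_mx x u, with
   x = usubmx z and u = dsubmx z; enorm z is then the joint Euclidean norm. *)

Definition gfun (R : realType) (n m : nat) (f : 'cV[R]_n -> R)
    (A : 'M[R]_(m, n)) (b p : 'cV[R]_m) (q : 'cV[R]_n) (rho mu : R)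
    (z : 'cV[R]_(n + m)) : R :=
  let x := usubmx z in
  let r := A *m x - dsubmx z + b in
  f x + dotv p r + rho / 2 * enorm r ^+ 2 + mu / 2 * enorm (x - q) ^+ 2.

Definition hpos (R : realType) (m : nat) (u : 'cV[R]_m) : R :=
  #|[set i | 0 < u i 0]%SET|%:R.

Definition Gfun (R : realType) (n m : nat) (g : 'cV[R]_(n + m) -> R)
    (lambda : R) (z : 'cV[R]_(n + m)) : R :=
  g z + lambda * hpos (dsubmx z).

Definition gradx (R : realType) (n m : nat) (g : 'cV[R]_(n + m) -> R)
    (z : 'cV[R]_(n + m)) : 'cV[R]_n := usubmx (grad g z).

Definition gradu (R : realType) (n m : nat) (g : 'cV[R]_(n + m) -> R)
    (z : 'cV[R]_(n + m)) : 'cV[R]_m := dsubmx (grad g z).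

Definition prox_hpos (R : realType) (m : nat) (c : R) (v : 'cV[R]_m) :
    set 'cV[R]_m :=
  [set z | forall w : 'cV[R]_m,
     c * hpos z + 2^-1 * enorm (z - v) ^+ 2
       <= c * hpos w + 2^-1 * enorm (w - v) ^+ 2].

Definition P_stationary (R : realType) (n m : nat) (g : 'cV[R]_(n + m) -> R)
    (lambda alpha : R) (z : 'cV[R]_(n + m)) (y : 'cV[R]_m) : Prop :=
  [/\ gradx g z = 0,
      y = - gradu g z
    & prox_hpos (alpha * lambda) (dsubmx z + alpha *: y) (dsubmx z)].

Definition strict_complementarity (R : realType) (m : nat) (u y : 'cV[R]_m) :
    Prop :=
  forall i, u i 0 + y i 0 != 0.

Definition subvec (R : realType) (m : nat) (T : {set 'I_m}) (v : 'cV[R]_m) :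
    'cV[R]_#|T| :=
  rowsub (fun k : 'I_#|T| => enum_val k) v.

(* Hessian of g with respect to the variables (x, u_T); for g = gfun f A b p q
   rho mu its blocks are hess f x + rho A^T A + mu I, - rho (A_T)^T, - rho A_T
   and rho I, where A_T consists of the rows of A indexed by T. *)
Definition hess_sub (R : realType) (n m : nat) (g : 'cV[R]_(n + m) -> R)
    (z : 'cV[R]_(n + m)) (T : {set 'I_m}) : 'M[R]_(n + #|T|) :=
  let s := fun k : 'I_#|T| => enum_val k in
  let H := hess g z in
  block_mx (ulsubmx H)          (colsub s (ursubmx H))
           (rowsub s (dlsubmx H)) (mxsub s s (drsubmx H)).

(* u - alpha \nabla_u g(x, u), i.e. u^j + alpha y^j at z = zeta^j *)
Definition forward_u (R : realType) (n m : nat) (g : 'cV[R]_(n + m) -> R)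
    (alpha : R) (z : 'cV[R]_(n + m)) : 'cV[R]_m :=
  let y := - gradu g z in dsubmx z + alpha *: y.

Definition Gamma (R : realType) (n m : nat) (g : 'cV[R]_(n + m) -> R)
    (lambda alpha : R) (z : 'cV[R]_(n + m)) : {set 'I_m} :=
  [set i | 0 <= forward_u g alpha z i 0 < Num.sqrt (2 * alpha * lambda)]%SET.

Definition half_u (R : realType) (n m : nat) (g : 'cV[R]_(n + m) -> R)
    (lambda alpha : R) (z : 'cV[R]_(n + m)) : 'cV[R]_m :=
  \col_i if i \in Gamma g lambda alpha z then 0 else forward_u g alpha z i 0.

Definition half_point (R : realType) (n m : nat) (g : 'cV[R]_(n + m) -> R)
    (lambda alpha t : R) (z : 'cV[R]_(n + m)) : 'cV[R]_(n + m) :=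
  let x := usubmx z in
  let uh := half_u g lambda alpha z in
  col_mx (x - t *: gradx g (col_mx x uh)) uh.

Definition newton_point (R : realType) (n m : nat) (g : 'cV[R]_(n + m) -> R)
    (Gam : {set 'I_m}) (zh zt : 'cV[R]_(n + m)) : Prop :=
  let T := (~: Gam)%SET in
  subvec Gam (dsubmx zt) = 0 /\
  hess_sub g zh T *m
    col_mx (usubmx zt - usubmx zh) (subvec T (dsubmx zt - dsubmx zh))
  = - col_mx (gradx g zh) (subvec T (gradu g zh)).

(* One iteration z -> z'. The Newton system has exactly one solution zt when g
   is strongly convex, so the existential merely names it. *)
Definition GSNewton_step (R : realType) (n m : nat) (g : 'cV[R]_(n + m) -> R)
    (lambda sigma_g alpha t : R) (z z' : 'cV[R]_(n + m)) : Prop :=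
  let zh := half_point g lambda alpha t z in
  exists2 zt, newton_point g (Gamma g lambda alpha z) zh zt
    & z' = if sigma_g / 4 * enorm (zt - zh) ^+ 2
                <= Gfun g lambda zh - Gfun g lambda zt
           then zt else zh.

Definition GSNewton_seq (R : realType) (n m : nat) (g : 'cV[R]_(n + m) -> R)
    (lambda sigma_g alpha t : R) (zeta : nat -> 'cV[R]_(n + m)) : Prop :=
  forall j, GSNewton_step g lambda sigma_g alpha t (zeta j) (zeta j.+1).

(* Main.v *)
(* Once the iterates are close to zhat, Gamma_j is exactly {i | uhat_i = 0}.
   Both kinds of steps set the indices in Gamma_j to 0, so those satisfy
   uhat_i = 0. Conversely, let uhat_i = 0 and i lie outside Gamma_j. Since the
   u-gradient of g is affine, it vanishes at index i after an accepted Newton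
   step, while a rejected one yields the forward step u_i + alpha y_i; both are
   incompatible with the limits uhat_i = 0 and yhat_i, nonzero by strict
   complementarity.

   From then on the method is Newton's method for the smooth strongly convex
   restriction of g to the subspace {u_Gamma = 0}, on which ||u_+||_0 is locally
   constant and zhat is critical: coercivity and Lipschitz continuity of the
   Hessian give |zt - zhat| <= (L_g / sigma_g) |zh - zhat|^2 for the Newton
   point zt and the half point zh, as well as the acceptance of zt, and
   |zh - zhat|^2 <= ((1 + alpha ell_g)^2 + (1 + eta1)^2) |z - zhat|^2. *)
Require Import Defs.
From mathcomp Require Import all_boot all_order all_algebra.
From mathcomp Require Import all_classical all_reals all_analysis.
From mathcomp Require Import ring lra.

Set Implicit Arguments.
Unset Strict Implicit.
Unset Printing Implicit Defensive.

Import Order.TTheory GRing.Theory Num.Theory.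
Import numFieldNormedType.Exports.

Local Open Scope classical_set_scope.
Local Open Scope ring_scope.

(** * Euclidean inner product, Euclidean norm and operator norm *)

Section Euclidean.
Context {R : realType}.
Implicit Types (n m : nat).

Lemma dotvC n (v w : 'cV[R]_n) : dotv v w = dotv w v.
Proof. by apply: eq_bigr => i _; rewrite mulrC. Qed.

Lemma dotvDl n (v1 v2 w : 'cV[R]_n) : dotv (v1 + v2) w = dotv v1 w + dotv v2 w.
Proof.
by rewrite /dotv -big_split; apply: eq_bigr => i _; rewrite mxE mulrDl.
Qed.

Lemma dotvZl n a (v w : 'cV[R]_n) : dotv (a *: v) w = a * dotv v w.
Proof.
by rewrite /dotv mulr_sumr; apply: eq_bigr => i _; rewrite mxE mulrA.
Qed.

Lemma dotvNl n (v w : 'cV[R]_n) : dotv (- v) w = - dotv v w.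
Proof. by rewrite -scaleN1r dotvZl mulN1r. Qed.

Lemma dotvBl n (v1 v2 w : 'cV[R]_n) : dotv (v1 - v2) w = dotv v1 w - dotv v2 w.
Proof. by rewrite dotvDl dotvNl. Qed.

Lemma dotvDr n (v w1 w2 : 'cV[R]_n) : dotv v (w1 + w2) = dotv v w1 + dotv v w2.
Proof. by rewrite dotvC dotvDl !(dotvC v). Qed.

Lemma dotvZr n a (v w : 'cV[R]_n) : dotv v (a *: w) = a * dotv v w.
Proof. by rewrite dotvC dotvZl (dotvC v). Qed.

Lemma dotvNr n (v w : 'cV[R]_n) : dotv v (- w) = - dotv v w.
Proof. by rewrite dotvC dotvNl (dotvC v). Qed.

Lemma dotvBr n (v w1 w2 : 'cV[R]_n) : dotv v (w1 - w2) = dotv v w1 - dotv v w2.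
Proof. by rewrite dotvDr dotvNr. Qed.

Lemma dotv_ge0 n (v : 'cV[R]_n) : 0 <= dotv v v.
Proof. by apply: sumr_ge0 => i _; rewrite -expr2 sqr_ge0. Qed.

Lemma enorm_ge0 n (v : 'cV[R]_n) : 0 <= enorm v.
Proof. exact: sqrtr_ge0. Qed.

Lemma enorm_sqr n (v : 'cV[R]_n) : enorm v ^+ 2 = dotv v v.
Proof. exact/sqr_sqrtr/dotv_ge0. Qed.

Lemma enorm0_eq0 n (v : 'cV[R]_n) : enorm v = 0 -> v = 0.
Proof.
move=> v0; have /eqP : dotv v v = 0 by rewrite -enorm_sqr v0 expr0n.
rewrite psumr_eq0 => [/allP/= dv0|i _]; last by rewrite -expr2 sqr_ge0.
apply/colP => i; rewrite mxE; apply/eqP.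
by have := dv0 i (mem_index_enum _); rewrite mulf_eq0 orbb.
Qed.

Lemma enorm0 n : enorm (0 : 'cV[R]_n) = 0.
Proof.
by rewrite /enorm /dotv big1 ?sqrtr0// => i _; rewrite mxE mul0r.
Qed.

Lemma enormZ n a (v : 'cV[R]_n) : enorm (a *: v) = `|a| * enorm v.
Proof.
rewrite /enorm dotvZl dotvZr mulrA -expr2 sqrtrM ?sqr_ge0// sqrtr_sqr//.
Qed.

Lemma enormN n (v : 'cV[R]_n) : enorm (- v) = enorm v.
Proof. by rewrite -scaleN1r enormZ normrN1 mul1r. Qed.

Lemma enormBC n (v w : 'cV[R]_n) : enorm (v - w) = enorm (w - v).
Proof. by rewrite -enormN opprB. Qed.

(** Cauchy-Schwarz, by expanding the nonnegative square of [enorm w *: v - enorm v *: w]. *)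
Lemma dotv_le_enorm n (v w : 'cV[R]_n) : dotv v w <= enorm v * enorm w.
Proof.
have [v0|vn0] := eqVneq (enorm v) 0.
  rewrite (enorm0_eq0 v0) enorm0 mul0r /dotv big1// => i _.
  by rewrite mxE mul0r.
have [w0|wn0] := eqVneq (enorm w) 0.
  rewrite (enorm0_eq0 w0) enorm0 mulr0 /dotv big1// => i _.
  by rewrite mxE mulr0.
have vwgt0 : 0 < enorm v * enorm w.
  by rewrite mulr_gt0// lt0r ?vn0 ?wn0 enorm_ge0.
have := dotv_ge0 (enorm w *: v - enorm v *: w).
rewrite dotvBl !dotvBr !dotvZl !dotvZr -!enorm_sqr (dotvC w v) => h.
rewrite -(ler_pM2l vwgt0); nra.
Qed.

Lemma enormD n (v w : 'cV[R]_n) : enorm (v + w) <= enorm v + enorm w.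
Proof.
rewrite -ler_sqr ?nnegrE ?addr_ge0 ?enorm_ge0//.
rewrite enorm_sqr dotvDl !dotvDr (dotvC w v) sqrrD !enorm_sqr.
by have := dotv_le_enorm v w; lra.
Qed.

Lemma enormB n (v w : 'cV[R]_n) : enorm (v - w) <= enorm v + enorm w.
Proof. by rewrite (le_trans (enormD _ _))// enormN. Qed.

Lemma le_coord_enorm n (v : 'cV[R]_n) i : `|v i 0| <= enorm v.
Proof.
rewrite -ler_sqr ?nnegrE ?enorm_ge0// enorm_sqr /dotv (bigD1 i)//=.
rewrite real_normK ?num_real// expr2 lerDl.
by apply: sumr_ge0 => j _; rewrite -expr2 sqr_ge0.
Qed.

Lemma ler_enorm_coord n (v w : 'cV[R]_n) :
  (forall i, `|v i 0| <= `|w i 0|) -> enorm v <= enorm w.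
Proof.
move=> vw; rewrite ler_wsqrtr//; apply: ler_sum => i _.
by rewrite -!expr2 -(real_normK (num_real (v _ _)))
  -(real_normK (num_real (w _ _))) ler_sqr ?nnegrE.
Qed.

Lemma dotv_split n m (v w : 'cV[R]_(n + m)) :
  dotv v w = dotv (usubmx v) (usubmx w) + dotv (dsubmx v) (dsubmx w).
Proof.
rewrite /dotv big_split_ord; congr (_ + _).
  by apply: eq_bigr => i _; rewrite !mxE.
by apply: eq_bigr => i _; rewrite !mxE.
Qed.

Lemma enorm_sqr_split n m (v : 'cV[R]_(n + m)) :
  enorm v ^+ 2 = enorm (usubmx v) ^+ 2 + enorm (dsubmx v) ^+ 2.
Proof. by rewrite !enorm_sqr dotv_split. Qed.

Lemma enorm_usubmx_le n m (v : 'cV[R]_(n + m)) : enorm (usubmx v) <= enorm v.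
Proof.
by rewrite -ler_sqr ?nnegrE ?enorm_ge0// enorm_sqr_split lerDl sqr_ge0.
Qed.

Lemma enorm_dsubmx_le n m (v : 'cV[R]_(n + m)) : enorm (dsubmx v) <= enorm v.
Proof.
by rewrite -ler_sqr ?nnegrE ?enorm_ge0// enorm_sqr_split lerDr sqr_ge0.
Qed.

(** Cauchy-Schwarz in each row. This Frobenius bound shows that the set whose supremum is [opnorm M]
    is bounded above. *)
Lemma enorm_mulmx_le m n (M : 'M[R]_(m, n)) (d : 'cV[R]_n) :
  enorm (M *m d) <= Num.sqrt (\sum_i enorm (row i M)^T ^+ 2) * enorm d.
Proof.
have Mge0 : 0 <= \sum_i enorm (row i M)^T ^+ 2.
  by apply: sumr_ge0 => i _; rewrite sqr_ge0.
rewrite -ler_sqr ?nnegrE ?mulr_ge0 ?enorm_ge0 ?sqrtr_ge0//.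
rewrite exprMn [X in X <= _]enorm_sqr sqr_sqrtr// /dotv mulr_suml.
apply: ler_sum => i _.
have -> : (M *m d) i 0 = dotv (row i M)^T d.
  by rewrite mxE; apply: eq_bigr => j _; rewrite !mxE.
rewrite -expr2 -exprMn -(real_normK (num_real (dotv _ _))).
rewrite ler_sqr ?nnegrE ?mulr_ge0 ?enorm_ge0// ler_norml dotv_le_enorm andbT.
by rewrite lerNl -dotvNl (le_trans (dotv_le_enorm _ _))// enormN.
Qed.

Lemma enorm_mulmx_opnorm m n (M : 'M[R]_(m, n)) (d : 'cV[R]_n) :
  enorm (M *m d) <= opnorm M * enorm d.
Proof.
have [d0|dn0] := eqVneq (enorm d) 0.
  by rewrite d0 (enorm0_eq0 d0) mulmx0 enorm0 mulr0.
have dgt0 : 0 < enorm d by rewrite lt0r dn0 enorm_ge0.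
rewrite -ler_pdivrMr// -[X in X <= _](ger0_norm (divr_ge0 _ _)) ?enorm_ge0//.
rewrite mulrC normrM [X in _ * X]ger0_norm ?enorm_ge0// -enormZ scalemxAr.
apply: ub_le_sup; last first.
  exists ((enorm d)^-1 *: d) => //=.
  by rewrite enormZ ger0_norm ?invr_ge0 ?enorm_ge0// mulVf.
exists (Num.sqrt (\sum_i enorm (row i M)^T ^+ 2)) => _ [e /= e1 <-].
by rewrite (le_trans (enorm_mulmx_le _ _))// ler_piMr// sqrtr_ge0.
Qed.

End Euclidean.

(** * Derivatives along lines, strong convexity and a Taylor estimate *)

Section Calculus.
Context {R : realType} {n : nat}.
Implicit Types (g : 'cV[R]_n -> R) (x y z d v : 'cV[R]_n).

Lemma derive_sum_coord g z v : differentiable g z ->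
  'D_v g z = \sum_i 'D_(delta_mx i 0) g z * v i 0.
Proof.
move=> dg; have vE : v = \sum_i v i 0 *: delta_mx i 0.
  rewrite [LHS]matrix_sum_delta; apply: eq_bigr => i _.
  by rewrite big_ord1.
rewrite deriveE// {1}vE linear_sum; apply: eq_bigr => i _.
by rewrite linearZ/= deriveE// [LHS]mulrC.
Qed.

Lemma derive_grad g z v : differentiable g z -> 'D_v g z = dotv (grad g z) v.
Proof.
by move=> /derive_sum_coord ->; apply: eq_bigr => i _; rewrite mxE.
Qed.

Lemma derive_gradi g z v i : differentiable (fun y => grad g y i 0) z ->
  'D_v (fun y => grad g y i 0) z = (hess g z *m v) i 0.
Proof.
by move=> /derive_sum_coord ->; rewrite mxE; apply: eq_bigr => j _; rewrite mxE.
Qed.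

Lemma is_derive_line (F : 'cV[R]_n -> R) z d (s : R) :
  derivable F (z + s *: d) d ->
  is_derive s 1 (fun r => F (z + r *: d)) ('D_d F (z + s *: d)).
Proof.
have quoE : (fun h : R =>
    h^-1 *: (((fun r => F (z + r *: d)) \o shift s) (h *: 1) -
    F (z + s *: d))) =
  (fun h => h^-1 *: ((F \o shift (z + s *: d)) (h *: d) - F (z + s *: d))).
  apply/funext => h /=; congr (_ *: (F _ - _)).
  by rewrite [h%:A]mulr1 scalerDl addrCA.
by move=> dF; split; rewrite /derivable /derive quoE.
Qed.

Lemma mean_value_line (F : 'cV[R]_n -> R) z d :
  (forall x, differentiable F x) ->
  exists2 c : R, 0 <= c <= 1 & F (z + d) - F z = 'D_d F (z + c *: d).
Proof.
move=> dF; pose phi (r : R) := F (z + r *: d).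
have dphi (r : R) : is_derive r 1 phi ('D_d F (z + r *: d)).
  exact/is_derive_line/diff_derivable.
have [|c c01] := @MVT R phi (fun r : R => 'D_d F (z + r *: d)) 0 1 ltr01.
  apply: derivable_within_continuous => r _; exact: ex_derive.
rewrite /phi scale1r scale0r addr0 subr0 mulr1 => ->.
by exists c => //; move: c01; rewrite in_itv/= => /andP[/ltW-> /ltW->].
Qed.

(** Strong convexity at the point x + h(y - x), divided by [h], leaves the quadratic term with the
    factor [1 - h]; then [h] tends to 0 from the right. *)
Lemma derive_le_convex g c x y : differentiable g x ->
  strongly_convex g c ->
  'D_(y - x) g x + c / 2 * enorm (y - x) ^+ 2 <= g y - g x.
Proof.
move=> dg cg; set d := y - x.
have key (h : R) : 0 < h -> h < 1 ->
    h^-1 *: ((g \o shift x) (h *: d) - g x) <=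
    g y - g x - c / 2 * enorm d ^+ 2 * (1 - h).
  move=> h0 h1; have h0' := ltW h0; have h1' := ltW h1.
  have : g (h *: y + (1 - h) *: x) -
      c / 2 * enorm (h *: y + (1 - h) *: x) ^+ 2 <=
      h * (g y - c / 2 * enorm y ^+ 2) + (1 - h) * (g x - c / 2 * enorm x ^+ 2).
    exact: (cg (Itv01 h0' h1') y x (in_setT _) (in_setT _)).
  have eyx : h *: y + (1 - h) *: x = h *: d + x.
    by rewrite scalerBl scale1r addrCA /d scalerBr addrC.
  have yE : y = x + d by rewrite /d addrC subrK.
  clearbody d.
  rewrite eyx !enorm_sqr [in dotv y y]yE.
  rewrite !dotvDl !dotvDr !dotvZl !dotvZr (dotvC d x) => cgh.
  rewrite -[_ *: _]/(_ * _) ler_pdivrMl//=; lra.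
have dgv : derivable g x d by exact: diff_derivable.
rewrite -lerBrDr.
have cl : (h^-1 *: ((g \o shift x) (h *: d) - g x)) @[h --> 0^'+] --> 'D_d g x.
  by apply: cvg_dnbhs_at_right; exact: dgv.
have cr : (g y - g x - c / 2 * enorm d ^+ 2 * (1 - h)) @[h --> (0 : R)^'+] -->
    g y - g x - c / 2 * enorm d ^+ 2 * (1 - 0).
  apply: cvg_at_right_filter; apply: cvgB; first exact: cvg_cst.
  by apply: cvgM; [exact: cvg_cst|apply: cvgB; [exact: cvg_cst|exact: cvg_id]].
rewrite subr0 mulr1 in cr.
apply: ler_cvg_to cl cr _.
near=> h; apply: key; near: h; [exact: nbhs_right_gt|exact: nbhs_right_lt].
Unshelve. all: by end_near. Qed.

Section SmoothStronglyConvex.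
Variables (g : 'cV[R]_n -> R) (L c : R).
Hypothesis dg : forall z, differentiable g z.
Hypothesis dgradg : forall z i, differentiable (fun y => grad g y i 0) z.
Hypothesis cg : strongly_convex g c.
Hypothesis lipg : lipschitz_hess g L.

Lemma strongly_convex_grad x y :
  g x + dotv (grad g x) (y - x) + c / 2 * enorm (y - x) ^+ 2 <= g y.
Proof.
have := derive_le_convex y (dg x) cg; rewrite derive_grad//; lra.
Qed.

Lemma strongly_monotone_grad x y :
  c * enorm (y - x) ^+ 2 <= dotv (y - x) (grad g y - grad g x).
Proof.
have h1 := strongly_convex_grad x y.
have := strongly_convex_grad y x.
rewrite enormBC -opprB dotvNr dotvBr !(dotvC (y - x)); lra.
Qed.

(** Pairing the gradient with a fixed [w] gives a scalar function, to which the mean value theorem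
    applies. *)
Lemma dotv_grad_sum w y :
  dotv w (grad g y) = (\sum_i (w i 0 *: fun y => grad g y i 0)) y.
Proof. by rewrite fct_sumE; apply: eq_bigr => i _. Qed.

Lemma differentiable_dotv_grad w z :
  differentiable (fun y => dotv w (grad g y)) z.
Proof.
rewrite (funext (dotv_grad_sum w)).
by apply: differentiable_sum => i; exact: differentiableZ.
Qed.

Lemma derive_dotv_grad w z d :
  'D_d (fun y => dotv w (grad g y)) z = dotv w (hess g z *m d).
Proof.
rewrite (funext (dotv_grad_sum w)) derive_sum => [|i]; last first.
  exact/derivableZ/diff_derivable.
apply: eq_bigr => i _; rewrite deriveZ; last exact: diff_derivable.
by rewrite derive_gradi.
Qed.

(** Strong monotonicity between [z] and [h *: e + z] bounds the difference quotient of
    [dotv e (grad g _)] along [e] from below; its limit is the Hessian form. *)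
Lemma hess_coercive z e : c * enorm e ^+ 2 <= dotv e (hess g z *m e).
Proof.
have cl : (h^-1 *: (dotv e (grad g (h *: e + z)) - dotv e (grad g z)))
    @[h --> 0^'+] --> dotv e (hess g z *m e).
  rewrite -derive_dotv_grad; apply: cvg_dnbhs_at_right.
  exact: (diff_derivable (differentiable_dotv_grad e z)).
apply: ler_cvg_to (cvg_cst _) cl _.
near=> h; have h0 : 0 < h by near: h; exact: nbhs_right_gt.
rewrite -[_ *: _]/(_ * _) ler_pdivlMl//.
have := strongly_monotone_grad z (h *: e + z).
rewrite addrK enormZ dotvZl dotvBr gtr0_norm//.
move=> hmono; rewrite -(ler_pM2l h0); apply: le_trans hmono.
by rewrite [leRHS](_ : _ = h * (h * (c * enorm e ^+ 2)))//; ring.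
Unshelve. all: by end_near. Qed.

(* The factor [1/2] of Taylor's formula is lost to the mean value theorem;
   the constant [eta] of the theorem leaves room for it. *)
Lemma dotv_grad_taylor w x y :
  dotv w (grad g y - grad g x - hess g x *m (y - x)) <=
  L * enorm (y - x) ^+ 2 * enorm w.
Proof.
have [L0 lip] := lipg.
have [s /andP[s0 s1] sE] :=
  mean_value_line x (y - x) (differentiable_dotv_grad w).
rewrite (addrC x) subrK derive_dotv_grad in sE.
rewrite !dotvBr sE -dotvBr -mulmxBl mulrC.
apply: le_trans (dotv_le_enorm _ _) _; rewrite ler_wpM2l ?enorm_ge0//.
apply: le_trans (enorm_mulmx_opnorm _ _) _.
rewrite expr2 mulrA ler_wpM2r ?enorm_ge0//.
apply: le_trans (lip _ _) _; rewrite ler_wpM2l// addrC addKr enormZ ger0_norm//.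
by rewrite ler_piMl// enorm_ge0.
Qed.

End SmoothStronglyConvex.
End Calculus.

(** * Smoothness of [gfun] and affinity of its u-gradient *)

Section QuadraticCoupling.
Context {R : realType}.

(** Serves to read derivatives off an exact expansion along a line. *)
Lemma derive_quadratic (V : normedModType R) (Q : V -> R) z v (a b : R) :
  (forall h, Q (h *: v + z) = Q z + h * a + h ^+ 2 * b) -> 'D_v Q z = a.
Proof.
move=> QE; rewrite /derive; apply: cvg_lim => //.
have cvgab : (a + h * b) @[h --> (0 : R)^'] --> a + 0 * b.
  apply: cvg_trans (_ : (a + h * b) @[h --> (0 : R)] --> a + 0 * b).
    by apply: cvg_app; exact: nbhs_dnbhs.
  by apply: cvgD; [exact: cvg_cst|apply: cvgM; [exact: cvg_id|exact: cvg_cst]].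
rewrite mul0r addr0 in cvgab; apply: cvg_trans cvgab.
apply: near_eq_cvg; near=> h.
have h0 : h != 0 by near: h; exact: nbhs_dnbhs_neq.
rewrite /= QE -[_ *: _]/(_ * _); by field.
Unshelve. all: by end_near. Qed.

Lemma differentiable_dotv (V : normedModType R) k (F G : V -> 'cV[R]_k) z :
  (forall i, differentiable (fun y => F y i 0) z) ->
  (forall i, differentiable (fun y => G y i 0) z) ->
  differentiable (fun y => dotv (F y) (G y)) z.
Proof.
move=> dF dG; rewrite (_ : (fun _ => _) =
    \sum_i ((fun y => F y i 0) * (fun y => G y i 0))).
  by apply: differentiable_sum => i; exact: differentiableM.
by apply/funext => y; rewrite fct_sumE.
Qed.

Lemma continuous_usubmx m n : continuous (usubmx : 'cV[R]_(n + m) -> 'cV[R]_n).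
Proof.
move=> u A /nbhs_ballP[e /= e0 eA]; apply/nbhs_ballP; exists e => //= v [_ uv].
by apply: eA; split=> // i j; rewrite !mxE; exact: uv.
Qed.

Lemma differentiable_usubmx m n z :
  differentiable (usubmx : 'cV[R]_(n + m) -> 'cV[R]_n) z.
Proof. exact/linear_differentiable/continuous_usubmx. Qed.

Context {n m : nat}.
Variables (f : 'cV[R]_n -> R) (A : 'M[R]_(m, n)).
Variables (b p : 'cV[R]_m) (q : 'cV[R]_n) (rho mu : R).
Hypothesis f2 : twice_cont_diff f.

Local Notation g := (gfun f A b p q rho mu).

(** The linear part of [residual], hence also its derivative in the direction [z]. *)
Definition coupling (z : 'cV[R]_(n + m)) : 'cV[R]_m := A *m usubmx z - dsubmx z.

Definition residual z : 'cV[R]_m := coupling z + b.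

Definition quad_part z : R :=
  dotv p (residual z) + rho / 2 * dotv (residual z) (residual z) +
  mu / 2 * dotv (usubmx z - q) (usubmx z - q).

Lemma residualP h v z : residual (h *: v + z) = h *: coupling v + residual z.
Proof.
rewrite /residual addrA; congr (_ + _).
by rewrite /coupling !linearP/= addrACA -scalerDr.
Qed.

Lemma gfunE : g = (f \o usubmx) + quad_part.
Proof.
apply/funext => z; transitivity (f (usubmx z) + quad_part z) => //.
by rewrite /gfun !enorm_sqr /quad_part !addrA.
Qed.

Lemma differentiable_residual i z : differentiable (fun y => residual y i 0) z.
Proof.
rewrite (_ : (fun _ => _) = (fun y => dotv (row i A)^T (usubmx y)) -
    (fun y => y (rshift n i) 0) + cst (b i 0)); last first.
  apply/funext => y; rewrite /residual /coupling !mxE [RHS]/(_ - _ + _)/=.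
  congr (_ - _ + _).
  by apply: eq_bigr => j _; rewrite !mxE.
apply: differentiableD => //; apply: differentiableB.
  apply: differentiable_dotv => j; first exact: differentiable_cst.
  rewrite (_ : (fun _ => _) = fun y : 'cV[R]_(n + m) => y (lshift m j) 0).
    exact: differentiable_coord.
  by apply/funext => y; rewrite mxE.
exact: differentiable_coord.
Qed.

Lemma differentiable_shift_usubmx i z :
  differentiable (fun y : 'cV[R]_(n + m) => (usubmx y - q) i 0) z.
Proof.
rewrite (_ : (fun _ => _) =
    (fun y : 'cV[R]_(n + m) => y (lshift m i) 0) - cst (q i 0)).
  by apply: differentiableB => //; exact: differentiable_coord.
by apply/funext => y; rewrite !mxE.
Qed.

Lemma differentiable_quad z : differentiable quad_part z.
Proof.
apply: differentiableD; first apply: differentiableD.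
- apply: differentiable_dotv => i; [exact: differentiable_cst|].
  exact: differentiable_residual.
- apply: differentiableM => //.
  by apply: differentiable_dotv => i; exact: differentiable_residual.
- apply: differentiableM => //.
  by apply: differentiable_dotv => i; exact: differentiable_shift_usubmx.
Qed.

Lemma differentiable_comp_usubmx z :
  differentiable (f \o (usubmx : 'cV[R]_(n + m) -> 'cV[R]_n)) z.
Proof.
case: f2 => df _ _; apply: differentiable_comp => //.
exact: differentiable_usubmx.
Qed.

Lemma differentiable_gfun z : differentiable g z.
Proof.
rewrite gfunE; apply: differentiableD; first exact: differentiable_comp_usubmx.
exact: differentiable_quad.
Qed.

Lemma derive_gfun z v : 'D_v g z =
  dotv (grad f (usubmx z)) (usubmx v) + dotv p (coupling v) +
  rho * dotv (residual z) (coupling v) + mu * dotv (usubmx z - q) (usubmx v).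
Proof.
rewrite gfunE deriveD; last 2 first.
- exact/diff_derivable/differentiable_comp_usubmx.
- exact/diff_derivable/differentiable_quad.
rewrite -!addrA; congr (_ + _).
  case: f2 => df _ _; rewrite -derive_grad// /derive /=.
  by under eq_fun do rewrite linearP.
(* Along [v] all terms but [f] form a quadratic polynomial in [h]; the supplied term is its
   coefficient of [h ^+ 2]. *)
apply: (@derive_quadratic _ _ _ _ _ (rho / 2 * dotv (coupling v) (coupling v) +
  mu / 2 * dotv (usubmx v) (usubmx v))) => h.
have xE : usubmx (h *: v + z) - q = h *: usubmx v + (usubmx z - q).
  by rewrite linearP addrA.
rewrite /quad_part residualP xE.
move: (coupling v) (residual z) (usubmx v) (usubmx z - q) => a c d e.
rewrite !(dotvDl, dotvDr, dotvZl, dotvZr) (dotvC a c) (dotvC d e); by field.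
Qed.

Lemma grad_gfun z i : grad g z i 0 =
  dotv (grad f (usubmx z)) (usubmx (delta_mx i 0)) +
  dotv p (coupling (delta_mx i 0)) +
  rho * dotv (residual z) (coupling (delta_mx i 0)) +
  mu * dotv (usubmx z - q) (usubmx (delta_mx i 0)).
Proof. by rewrite mxE derive_gfun. Qed.

Lemma differentiable_grad_gfun z i : differentiable (fun y => grad g y i 0) z.
Proof.
rewrite (funext (grad_gfun ^~ i)).
apply: differentiableD; first do 2?[apply: differentiableD].
- case: f2 => _ dgradf _; apply: differentiable_dotv => j.
    have dgradfj : differentiable (fun x => grad f x j 0) (usubmx z).
      exact: (differentiable_comp (dgradf _) (differentiable_coord _ j 0)).
    exact: (differentiable_comp (differentiable_usubmx z) dgradfj).
  exact: differentiable_cst.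
- exact: differentiable_cst.
- apply: differentiableM => //; apply: differentiable_dotv => j.
    exact: differentiable_residual.
  exact: differentiable_cst.
- apply: differentiableM => //; apply: differentiable_dotv => j.
    exact: differentiable_shift_usubmx.
  exact: differentiable_cst.
Qed.

(** A basis direction of the u-block leaves [x] fixed and [coupling] maps it to minus a basis
    vector, so the [f] and [mu] terms drop out. *)
Lemma gradu_gfun z i : grad g z (rshift n i) 0 = - p i 0 - rho * residual z i 0.
Proof.
have r0E : coupling (delta_mx (rshift n i) 0) = - delta_mx i 0.
  rewrite /coupling (_ : usubmx _ = 0); last first.
    by apply/colP => j; rewrite !mxE eq_lrshift.
  rewrite mulmx0 add0r; congr (- _).
  by apply/colP => j; rewrite !mxE eq_rshift.
have dot_delta (w : 'cV[R]_m) : dotv w (delta_mx i 0) = w i 0.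
  rewrite /dotv (bigD1 i)//= big1 => [|j /negPf ji];
    rewrite mxE ?eqxx ?ji ?andbT.
    by rewrite mulr1 addr0.
  by rewrite mulr0.
have dot0 (w : 'cV[R]_n) : dotv w (usubmx (delta_mx (rshift n i) 0)) = 0.
  by rewrite /dotv big1// => j _; rewrite !mxE eq_lrshift mulr0.
by rewrite grad_gfun r0E !dot0 !dotvNr !dot_delta add0r mulr0 addr0 mulrN.
Qed.

(** The u-gradient depends on [z] only through the affine [residual], so its derivative along [d] is
    an exact increment. *)
Lemma gradu_gfun_affine z d i :
  (hess g z *m d) (rshift n i) 0 =
  grad g (z + d) (rshift n i) 0 - grad g z (rshift n i) 0.
Proof.
rewrite -(derive_gradi _ (differentiable_grad_gfun z (rshift n i))).
apply: (@derive_quadratic _ _ _ _ _ 0) => h.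
have residualD : residual (z + d) = coupling d + residual z.
  by rewrite -[d in LHS]scale1r addrC residualP scale1r.
have affine (a1 a2 a3 : R) : a1 = - p i 0 - rho * residual (h *: d + z) i 0 ->
    a2 = - p i 0 - rho * residual z i 0 ->
    a3 = - p i 0 - rho * residual (z + d) i 0 ->
    a1 = a2 + h * (a3 - a2) + h ^+ 2 * 0.
  move=> -> -> ->; rewrite residualP residualD.
  by move: (coupling d) (residual z) => c r; rewrite !mxE; ring.
exact: affine (gradu_gfun _ i) (gradu_gfun _ i) (gradu_gfun _ i).
Qed.

End QuadraticCoupling.

(** * Proximal fixed points and the reduced Newton system *)

Section GSNewton.
Context {R : realType} {n m : nat}.
Implicit Types (z zh zt e : 'cV[R]_(n + m)) (S : {set 'I_m}).

(** Replace coordinate [i] alone by a value [t] that is positive only if [u i 0] is: [hpos] does not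
    grow, so [t] is no nearer to [v i 0] than [u i 0] is. If [t] can be [v i 0], equality
    follows. *)
Lemma prox_hpos_fixed (c : R) (u v : 'cV[R]_m) i : 0 <= c ->
  prox_hpos c v u -> u i 0 != 0 -> u i 0 = v i 0.
Proof.
move=> c0 uprox ui0.
have perturb (t : R) : (0 < t -> 0 < u i 0) ->
    (u i 0 - v i 0) ^+ 2 <= (t - v i 0) ^+ 2.
  move=> tpos; pose w := \col_j (if j == i then t else u j 0) : 'cV[R]_m.
  have hwu : hpos w <= hpos u.
    rewrite ler_nat subset_leq_card//; apply/fintype.subsetP => j.
    by rewrite !inE mxE; have [->|] := eqVneq j i.
  have := uprox w; rewrite !enorm_sqr /dotv (bigD1 i)//= [in leRHS](bigD1 i)//=.
  have -> : \sum_(j < m | j != i) (w - v) j 0 * (w - v) j 0 =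
            \sum_(j < m | j != i) (u - v) j 0 * (u - v) j 0.
    by apply: eq_bigr => j /negPf ji; rewrite !mxE ji.
  have := ler_wpM2l c0 hwu; rewrite !mxE eqxx -!expr2; lra.
have [u_le0|u_gt0] := leP (u i 0) 0; last first.
  have := perturb (v i 0) (fun=> u_gt0).
  rewrite subrr expr0n/= => h; apply/eqP; rewrite -subr_eq0 -sqrf_eq0.
  by rewrite eq_le h sqr_ge0.
have [v_le0|v_gt0] := leP (v i 0) 0.
  have : 0 < v i 0 -> 0 < u i 0 by rewrite ltNge v_le0.
  move=> /perturb; rewrite subrr expr0n/= => h; apply/eqP.
  by rewrite -subr_eq0 -sqrf_eq0 eq_le h sqr_ge0.
(* In the remaining case [u i 0 < 0 < v i 0], the value 0 would be strictly nearer to [v i 0]. *)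
have u_lt0 : u i 0 < 0 by rewrite lt_neqAle ui0.
have : (0 : R) < 0 -> 0 < u i 0 by rewrite ltxx.
by move=> /perturb; nra.
Qed.

(** A nonzero coordinate of [u] is fixed by the forward step [u + alpha *: y], which forces [y] to
    vanish there. *)
Lemma P_stationary_grad0 (g : 'cV[R]_(n + m) -> R) (lambda alpha : R) z y i :
  0 < lambda -> 0 < alpha -> P_stationary g lambda alpha z y ->
  z (rshift n i) 0 != 0 -> grad g z (rshift n i) 0 = 0.
Proof.
move=> lambda0 alpha0 [_ yE zprox] zi.
have zi' : dsubmx z i 0 != 0 by rewrite mxE.
have := prox_hpos_fixed (mulr_ge0 (ltW alpha0) (ltW lambda0)) zprox zi'.
rewrite yE !mxE => /eqP; rewrite -subr_eq0 opprD addrA subrr sub0r mulrN opprK.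
by rewrite mulf_eq0 gt_eqF//= => /eqP.
Qed.

Lemma sum_subvec S (F : 'I_m -> R) (v : 'cV[R]_m) :
  (forall i, i \notin S -> v i 0 = 0) ->
  \sum_k F (enum_val k) * subvec S v k 0 = \sum_i F i * v i 0.
Proof.
move=> vS; rewrite [RHS](bigID (mem S))/= [X in _ + X]big1 ?addr0; last first.
  by move=> i /vS ->; rewrite mulr0.
by rewrite [RHS]big_enum_val; apply: eq_bigr => k _; rewrite mxE.
Qed.

Definition vanish S z := forall i, i \in S -> z (rshift n i) 0 = 0.

Lemma vanishB S z1 z2 : vanish S z1 -> vanish S z2 -> vanish S (z1 - z2).
Proof. by move=> z1S z2S i iS; rewrite !mxE z1S// z2S// subrr. Qed.

Section NewtonPoint.
Variables (g : 'cV[R]_(n + m) -> R) (S : {set 'I_m}) (zh zt : 'cV[R]_(n + m)).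
Hypothesis newton : newton_point g S zh zt.
Hypothesis zhS : vanish S zh.

Lemma newton_point_vanish : vanish S zt.
Proof.
move=> i iS; case: newton => /colP/(_ (enum_rank_in iS i)) + _.
by rewrite !mxE enum_rankK_in.
Qed.

(** The step [zt - zh] vanishes on [S], so the Hessian columns deleted from the reduced system
    contribute nothing, and its rows are full Hessian rows. *)
Lemma newton_point_row :
  (forall k,
    (hess g zh *m (zt - zh)) (lshift m k) 0 = - grad g zh (lshift m k) 0) /\
  (forall i, i \notin S ->
    (hess g zh *m (zt - zh)) (rshift n i) 0 = - grad g zh (rshift n i) 0).
Proof.
have dS i : i \notin (~: S)%SET -> (dsubmx zt - dsubmx zh) i 0 = 0.
  by rewrite inE negbK => iS; rewrite !mxE newton_point_vanish// zhS// subrr.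
case: newton => _.
rewrite /hess_sub mul_block_col opp_col_mx => /eq_col_mx[xE uE].
split=> [k|i iS].
  have /colP/(_ k) := xE; rewrite !mxE big_split_ord/= => <-.
  congr (_ + _); first by apply: eq_bigr => j _; rewrite !mxE.
  rewrite (eq_bigr (fun j => hess g zh (lshift m k) (rshift n j) *
    (dsubmx zt - dsubmx zh) j 0)) => [|j _]; last by rewrite !mxE.
  by rewrite -(sum_subvec _ dS); apply: eq_bigr => j _; rewrite !mxE.
have iT : i \in (~: S)%SET by rewrite inE.
have /colP/(_ (enum_rank_in iT i)) := uE.
rewrite !mxE enum_rankK_in// big_split_ord/= => <-.
congr (_ + _); first by apply: eq_bigr => j _; rewrite !mxE enum_rankK_in.
rewrite (eq_bigr (fun j => hess g zh (rshift n i) (rshift n j) *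
  (dsubmx zt - dsubmx zh) j 0)) => [|j _]; last by rewrite !mxE.
rewrite -(sum_subvec _ dS); apply: eq_bigr => j _.
by rewrite !mxE enum_rankK_in.
Qed.

(** Weak form of the Newton equation: a test vector vanishing on [S] does not see the rows in [S],
    the only ones missing from the system. *)
Lemma dotv_newton_point e : vanish S e ->
  dotv e (hess g zh *m (zt - zh)) = - dotv e (grad g zh).
Proof.
move=> eS; have [xE uE] := newton_point_row.
rewrite -dotvNr /dotv !big_split_ord/=; congr (_ + _); apply: eq_bigr => i _.
  by rewrite xE [in RHS]mxE.
have [iS|iS] := boolP (i \in S); first by rewrite eS// !mul0r.
by rewrite uE// [in RHS]mxE.
Qed.

End NewtonPoint.

Lemma half_point_vanish (g : 'cV[R]_(n + m) -> R) (lambda alpha t : R) z :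
  vanish (Gamma g lambda alpha z) (half_point g lambda alpha t z).
Proof. by move=> i iG; rewrite col_mxEd mxE iG. Qed.

Lemma half_point_free (g : 'cV[R]_(n + m) -> R) (lambda alpha t : R) z i :
  i \notin Gamma g lambda alpha z ->
  half_point g lambda alpha t z (rshift n i) 0 =
  z (rshift n i) 0 - alpha * grad g z (rshift n i) 0.
Proof. by move=> /negPf iG; rewrite col_mxEd mxE iG !mxE mulrN. Qed.

Lemma GSNewton_step_vanish (g : 'cV[R]_(n + m) -> R)
    (lambda sigma alpha t : R) z z' :
  GSNewton_step g lambda sigma alpha t z z' ->
  vanish (Gamma g lambda alpha z) z'.
Proof.
move=> [zt newton ->]; case: ifP => _; last exact: half_point_vanish.
exact: newton_point_vanish newton.
Qed.

Lemma hpos_eq (u v : 'cV[R]_m) :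
  (forall i, (0 < u i 0) = (0 < v i 0)) -> hpos u = hpos v.
Proof.
by move=> uv; congr (_%:R); apply: eq_card => i; rewrite !inE uv.
Qed.

Lemma colB_coord k (v w : 'cV[R]_k) i : (v - w) i 0 = v i 0 - w i 0.
Proof. by rewrite !mxE. Qed.

Definition zero_set z : {set 'I_m} := [set i | z (rshift n i) 0 == 0]%SET.

(** * Local estimates near the limit point *)

Section LocalAnalysis.
Variables (g : 'cV[R]_(n + m) -> R) (lambda sigma ell L alpha t : R).
Variable zhat : 'cV[R]_(n + m).
Hypothesis dg : forall z, differentiable g z.
Hypothesis dgradg : forall z i, differentiable (fun y => grad g y i 0) z.
Hypothesis gradu_affine : forall z d i, (hess g z *m d) (rshift n i) 0 =
  grad g (z + d) (rshift n i) 0 - grad g z (rshift n i) 0.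
Hypothesis sigma_gt0 : 0 < sigma.
Hypothesis cg : strongly_convex g sigma.
Hypothesis lipg : lipschitz_grad g ell.
Hypothesis liph : lipschitz_hess g L.
Hypothesis alpha_gt0 : 0 < alpha.
Hypothesis t_gt0 : 0 < t.
Hypothesis gradx0 : gradx g zhat = 0.
Hypothesis gradu0 :
  forall i, zhat (rshift n i) 0 != 0 -> grad g zhat (rshift n i) 0 = 0.

Local Notation S0 := (zero_set zhat).
Local Notation eta1 := (t * ell * (1 + alpha * ell)).

Lemma zhat_vanish : vanish S0 zhat.
Proof. by move=> i; rewrite inE => /eqP. Qed.

(** Criticality of [zhat] on the subspace: [gradx0] kills the x-block, [gradu0] the u-indices
    outside the zero set, and [e] those inside. *)
Lemma dotv_grad_zhat e : vanish S0 e -> dotv e (grad g zhat) = 0.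
Proof.
move=> eS; rewrite dotv_split -/(gradx g zhat) gradx0 -[RHS]addr0.
congr (_ + _).
  by rewrite /dotv big1// => i _; rewrite !mxE mulr0.
rewrite /dotv big1// => i _; rewrite [dsubmx e i 0]mxE [dsubmx _ i 0]mxE.
have [/eqP zi|/gradu0->] := boolP (zhat (rshift n i) 0 == 0);
  last by rewrite mulr0.
by rewrite eS ?mul0r// inE zi.
Qed.

Lemma grad_coord_le z i :
  `|grad g z i 0 - grad g zhat i 0| <= ell * enorm (z - zhat).
Proof.
case: lipg => _ /(_ z zhat); apply: le_trans.
by have := le_coord_enorm (grad g z - grad g zhat) i; rewrite colB_coord.
Qed.

Lemma half_point_le z : Gamma g lambda alpha z = S0 ->
  enorm (half_point g lambda alpha t z - zhat) ^+ 2 <=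
  ((1 + alpha * ell) ^+ 2 + (1 + eta1) ^+ 2) * enorm (z - zhat) ^+ 2.
Proof.
move=> GS; have [ell0 lip] := lipg.
set E := enorm (z - zhat); have E0 : 0 <= E by exact: enorm_ge0.
(* The point at which the half step evaluates the x-gradient. On the zero set [w] and [zhat] both
   vanish; outside it the u-gradient at [zhat] is 0 and may be subtracted. This gives the two masked
   differences below. *)
pose w := col_mx (usubmx z) (half_u g lambda alpha z).
have wE : enorm (w - zhat) <= (1 + alpha * ell) * E.
  pose mask (v : 'cV[R]_m) := \col_i (if i \in S0 then 0 else v i 0) : 'cV[R]_m.
  have -> : w - zhat =
      col_mx (usubmx (z - zhat)) (mask (dsubmx (z - zhat))) -
      alpha *: col_mx 0 (mask (dsubmx (grad g z - grad g zhat))).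
    rewrite -[zhat in LHS]vsubmxK scale_col_mx !opp_col_mx !add_col_mx.
    congr (col_mx _ _); first by rewrite scaler0 subr0 linearB.
    apply/colP => i; have [iS|iS] := boolP (i \in S0).
      by rewrite !mxE GS iS zhat_vanish// mulr0 subrr.
    have gi0 : grad g zhat (rshift n i) 0 = 0.
      by apply: gradu0; rewrite inE in iS.
    rewrite !mxE GS (negPf iS).
    by move: gi0; rewrite mxE => ->; rewrite subr0 mulrN addrAC.
  apply: le_trans (enormB _ _) _; rewrite enormZ gtr0_norm// mulrDl mul1r.
  apply: lerD.
    apply: ler_enorm_coord => i; rewrite mxE; case: splitP => j ij.
      by rewrite mxE (_ : i = lshift m j)//; exact: val_inj.
    rewrite /mask mxE; case: ifP => _; first by rewrite normr0.
    by rewrite mxE (_ : i = rshift n j)//; exact: val_inj.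
  rewrite -mulrA ler_wpM2l ?(ltW alpha_gt0)//; apply: le_trans (lip _ _).
  apply: ler_enorm_coord => i; rewrite mxE; case: splitP => j ij.
    by rewrite mxE normr0.
  rewrite /mask mxE; case: ifP => _; first by rewrite normr0.
  by rewrite mxE (_ : i = rshift n j)//; exact: val_inj.
have aell0 : 0 <= alpha * ell by rewrite mulr_ge0// ltW.
have eta10 : 0 <= eta1 by rewrite !mulr_ge0 ?addr_ge0// ltW.
(* After the swap the u-block is matched with [1 + alpha * ell] and the x-block with [1 + eta1]. *)
rewrite enorm_sqr_split addrC mulrDl -!exprMn.
apply: lerD; rewrite ler_sqr ?nnegrE ?mulr_ge0 ?enorm_ge0 ?addr_ge0//.
  have -> : dsubmx (half_point g lambda alpha t z - zhat) = dsubmx (w - zhat).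
    by rewrite !linearB/= /half_point/= !col_mxKd.
  exact: le_trans (enorm_dsubmx_le _) wE.
have -> : usubmx (half_point g lambda alpha t z - zhat) =
    usubmx (z - zhat) - t *: usubmx (grad g w - grad g zhat).
  rewrite !linearB/= /half_point/= !col_mxKu -/(gradx g zhat) gradx0.
  rewrite !(scaler0, subr0, oppr0, addr0).
  by rewrite addrAC.
apply: le_trans (enormB _ _) _; rewrite enormZ gtr0_norm// mulrDl mul1r.
apply: lerD; first exact: enorm_usubmx_le.
rewrite -!mulrA ler_wpM2l ?(ltW t_gt0)//.
apply: le_trans (enorm_usubmx_le _) _; apply: le_trans (lip _ _) _.
by rewrite ler_wpM2l.
Qed.

(** For e = zt - zhat, the weak Newton equation and criticality turn <e, He> into a Taylor remainder
    between [zh] and [zhat] paired with e. Coercivity yields sigma |e|^2 <= L |zh - zhat|^2 |e|, and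
    |e| cancels. *)
Lemma newton_point_le zh zt : newton_point g S0 zh zt -> vanish S0 zh ->
  enorm (zt - zhat) <= L / sigma * enorm (zh - zhat) ^+ 2.
Proof.
move=> newton zhS; have ztS := newton_point_vanish newton.
have eS := vanishB ztS zhat_vanish.
have := dotv_grad_taylor dgradg liph (zt - zhat) zh zhat.
have -> : dotv (zt - zhat)
    (grad g zhat - grad g zh - hess g zh *m (zhat - zh)) =
    dotv (zt - zhat) (hess g zh *m (zt - zhat)).
  have -> : zhat - zh = (zt - zh) - (zt - zhat).
    by rewrite opprB [RHS]addrC addrA subrK.
  rewrite mulmxBr !dotvBr (dotv_newton_point newton zhS eS) dotv_grad_zhat//.
  by ring.
move=> /(le_trans (hess_coercive dg dgradg cg zh _)).
rewrite (enormBC zhat); set e := enorm (zt - zhat); set r := enorm _.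
have [->|e0] := eqVneq e 0 => [_|].
  by case: liph => L0 _; rewrite mulr_ge0 ?sqr_ge0// divr_ge0// ltW.
rewrite expr2 mulrA ler_pM2r ?lt0r ?e0 ?enorm_ge0// => h.
by rewrite mulrAC ler_pdivlMr// mulrC.
Qed.

(** For d = zt - zh, the weak Newton equation makes <d, grad g zt> a Taylor remainder, at most L
    |d|^3 <= (sigma/4) |d|^2. Strong convexity at [zt] supplies (sigma/2) |d|^2, of which half
    remains. *)
Lemma newton_point_descent zh zt : newton_point g S0 zh zt -> vanish S0 zh ->
  L * enorm (zt - zh) <= sigma / 4 ->
  sigma / 4 * enorm (zt - zh) ^+ 2 <= g zh - g zt.
Proof.
move=> newton zhS small; have ztS := newton_point_vanish newton.
have dS := vanishB ztS zhS.
have := dotv_grad_taylor dgradg liph (zt - zh) zh zt.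
rewrite !dotvBr (dotv_newton_point newton zhS dS) opprK subrK => taylor.
have := strongly_convex_grad dg cg zt zh.
rewrite -opprB dotvNr enormN (dotvC (grad g zt)).
have := ler_wpM2r (sqr_ge0 (enorm (zt - zh))) small.
lra.
Qed.

Lemma GSNewton_step_le z z' : GSNewton_step g lambda sigma alpha t z z' ->
  let r := enorm (half_point g lambda alpha t z - zhat) in
  Gamma g lambda alpha z = S0 -> L * r <= sigma / 8 ->
  (forall i, zhat (rshift n i) 0 != 0 -> r < `|zhat (rshift n i) 0|) ->
  enorm (z' - zhat) <= L / sigma * r ^+ 2.
Proof.
move=> [zt + ->] r GS; rewrite GS; set zh := half_point _ _ _ _ _ in r *.
move=> newton Lr rsmall; have [L0 _] := liph.
have zhS : vanish S0 zh by rewrite -GS; exact: half_point_vanish.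
have ztS := newton_point_vanish newton.
have ztr2 := newton_point_le newton zhS; rewrite -/r in ztr2.
have r0 : 0 <= r by exact: enorm_ge0.
have ztr : enorm (zt - zhat) <= r.
  apply: le_trans ztr2 _; rewrite expr2 mulrA ler_piMl// mulrAC.
  rewrite ler_pdivrMr// mul1r.
  by apply: le_trans Lr _; have := sigma_gt0; lra.
suff -> : sigma / 4 * enorm (zt - zh) ^+ 2 <=
    Gfun g lambda zh - Gfun g lambda zt.
  exact: ztr2.
(* Both points lie within [r] of [zhat], less than any nonzero |zhat_i|, so positivity agrees
   coordinatewise and the counts cancel: the acceptance test concerns [g] alone. *)
have -> : Gfun g lambda zh - Gfun g lambda zt = g zh - g zt.
  rewrite /Gfun (@hpos_eq (dsubmx zh) (dsubmx zt)); first ring.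
  move=> i; rewrite [dsubmx zh i 0]mxE [dsubmx zt i 0]mxE.
  have [/eqP zi|zi] := boolP (zhat (rshift n i) 0 == 0).
    by rewrite zhS ?ztS ?inE ?zi.
  have := rsmall i zi; have := le_coord_enorm (zh - zhat) (rshift n i).
  have := le_coord_enorm (zt - zhat) (rshift n i); rewrite -/r !colB_coord.
  move=> /le_trans/(_ ztr) h1 h2 h3.
  have := le_lt_trans h1 h3; have := le_lt_trans h2 h3.
  rewrite !ltr_norml ; have [|] := ltrP 0 (zhat (rshift n i) 0) => s.
    by rewrite (gtr0_norm s) => /andP[? _] /andP[? _]; apply/idP/idP => _; lra.
  by rewrite (ler0_norm s) => /andP[_ ?] /andP[_ ?]; apply/idP/idP => ?; lra.
apply: newton_point_descent => //.
(* This doubling is why [L * r] is required to be at most [sigma / 8]. *)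
have : enorm (zt - zh) <= r + r.
  rewrite (_ : zt - zh = (zt - zhat) - (zh - zhat)); last first.
    by rewrite opprB addrA subrK.
  by apply: le_trans (enormB _ _) _; rewrite lerD.
by move=> /(ler_wpM2l L0); lra.
Qed.

(** The alternatives are an accepted and a rejected Newton step. Along the iterates both right sides
    tend to 0, while strict complementarity keeps the left sides positive constants. *)
Lemma GSNewton_step_free z z' i : GSNewton_step g lambda sigma alpha t z z' ->
  zhat (rshift n i) 0 = 0 -> i \notin Gamma g lambda alpha z ->
  `|grad g zhat (rshift n i) 0| <= ell * enorm (z' - zhat) \/
  alpha * `|grad g zhat (rshift n i) 0| <=
    enorm (z' - zhat) + (1 + alpha * ell) * enorm (z - zhat).
Proof.
move=> [zt newton ->] zi iG; case: ifP => _.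
  left.
  have [_ /(_ i iG)] := newton_point_row newton (@half_point_vanish _ _ _ _ _).
  (* By affinity the Newton row says that component [i] of the gradient vanishes at [zt]. *)
  rewrite gradu_affine subrKC => /eqP; rewrite subr_eq addNr => /eqP ztE.
  by have := grad_coord_le zt (rshift n i); rewrite ztE sub0r normrN.
right; set zh := half_point _ _ _ _ _.
have zhi : zh (rshift n i) 0 =
    z (rshift n i) 0 - alpha * grad g z (rshift n i) 0.
  exact: half_point_free.
have := le_coord_enorm (zh - zhat) (rshift n i).
have := le_coord_enorm (z - zhat) (rshift n i).
have := ler_wpM2l (ltW alpha_gt0) (grad_coord_le z (rshift n i)).
rewrite -(gtr0_norm alpha_gt0) -!normrM (gtr0_norm alpha_gt0).
rewrite !colB_coord zhi zi !subr0.
move=> h1 h2 h3.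
rewrite (_ : alpha * grad g zhat _ _ = z (rshift n i) 0 -
  (z (rshift n i) 0 - alpha * grad g z (rshift n i) 0) -
  alpha * (grad g z (rshift n i) 0 - grad g zhat (rshift n i) 0)); last ring.
apply: le_trans (ler_normB _ _) _; apply: le_trans (lerD (ler_normB _ _) h1) _.
by lra.
Qed.

End LocalAnalysis.
End GSNewton.

(** * Passage to the limit along the iterates *)

Lemma continuous_enorm_shift (R : realType) n (a : 'cV[R]_n) :
  continuous (fun z : 'cV[R]_n => enorm (z - a)).
Proof.
suff h :
    continuous ((@Num.sqrt R) \o (fun z : 'cV[R]_n => dotv (z - a) (z - a))).
  exact: h.
move=> z; apply: continuous_comp; last exact: sqrt_continuous.
apply: differentiable_continuous.
have dB i : differentiable (fun y : 'cV[R]_n => (y - a) i 0) z.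
  rewrite (_ : (fun _ => _) = (fun y : 'cV[R]_n => y i 0) - cst (a i 0)).
    by apply: differentiableB => //; exact: differentiable_coord.
  by apply/funext => y; rewrite !mxE.
exact: differentiable_dotv.
Qed.

Theorem theorem9 (R : realType) (n m : nat)
    (f : 'cV[R]_n -> R) (A : 'M[R]_(m, n)) (b p : 'cV[R]_m) (q : 'cV[R]_n)
    (lambda rho mu sigma_f ell_f L_f ell_g L_g alpha t : R)
    (zeta : nat -> 'cV[R]_(n + m)) (zhat : 'cV[R]_(n + m)) (yhat : 'cV[R]_m) :
  let g := gfun f A b p q rho mu in
  let sigma_g := mu - sigma_f in
  let eta1 := t * ell_g * (1 + alpha * ell_g) in
  let eta := L_g / sigma_g *
    Num.max (alpha ^+ 2 * ell_g ^+ 2 + eta1 ^+ 2)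
            ((1 + alpha * ell_g) ^+ 2 + (1 + eta1) ^+ 2) in
  0 < lambda -> 0 < rho -> 0 < mu -> sigma_f < mu ->
  twice_cont_diff f ->
  weakly_convex f sigma_f ->
  lipschitz_grad f ell_f ->
  lipschitz_hess f L_f ->
  strongly_convex g sigma_g ->
  lipschitz_grad g ell_g ->
  lipschitz_hess g L_g ->
  0 < alpha < 1 / ell_g ->
  0 < t < 2 / ell_g ->
  GSNewton_seq g lambda sigma_g alpha t zeta ->
  zeta @ \oo --> zhat ->
  P_stationary g lambda alpha zhat yhat ->
  strict_complementarity (dsubmx zhat) yhat ->
  exists jhat : nat, forall j : nat, (jhat <= j)%N ->
    enorm (zeta j.+1 - zhat) <= eta * enorm (zeta j - zhat) ^+ 2.
Proof.
move=> g sigma_g eta1 eta lambda0 rho0 mu0 sfmu f2 _ _ _ cg lipg liph.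
move=> /andP[alpha0 _] /andP[t0 _] newton zeta_cvg stat compl.
have dg := differentiable_gfun A b p q rho mu f2 : forall z, differentiable g z.
have dgradg := differentiable_grad_gfun A b p q rho mu f2 :
  forall z i, differentiable (fun y => grad g y i 0) z.
have affine := gradu_gfun_affine A b p q rho mu f2.
have sigma0 : 0 < sigma_g by rewrite subr_gt0.
have [ell0 _] := lipg; have [L0 _] := liph.
have gradx0 : gradx g zhat = 0 by case: stat.
have gradu0 i := P_stationary_grad0 (i := i) lambda0 alpha0 stat.
pose a j := enorm (zeta j - zhat).
(* Convergence of [zeta] is in the sup norm topology; continuity of the Euclidean distance transfers
   it. *)
have a_cvg0 : a @ \oo --> (0 : R).
  rewrite -[X in _ --> X](enorm0 (n + m)) -(subrr zhat).
  exact: (cvg_comp _ _ zeta_cvg (@continuous_enorm_shift _ _ zhat zhat)).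
have a1_cvg0 : (fun j => a j.+1) @ \oo --> (0 : R) by rewrite cvg_shiftS.
have small u c (e : R) : u @ \oo --> (0 : R) -> 0 < e ->
    \forall j \near \oo, c * u j < e.
  move=> u0 e0; apply: (cvgr_lt (c * 0)); last by rewrite mulr0.
  by apply: cvgM => //; exact: cvg_cst.
have GammaE :
    \forall j \near \oo, Gamma g lambda alpha (zeta j) = zero_set zhat.
  suff : \forall j \near \oo, forall i,
      (i \in Gamma g lambda alpha (zeta j)) = (zhat (rshift n i) 0 == 0).
    by apply: filterS => j GE; apply/finset.setP => i; rewrite GE inE.
  (* There are finitely many indices, so each may have its own threshold. *)
  apply: filter_forall => i.
  have [zi|zi] := eqVneq (zhat (rshift n i) 0) 0; last first.
    have zi0 : 0 < `|zhat (rshift n i) 0| by rewrite normr_gt0.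
    (* If [i] were in [Gamma], the next iterate would vanish at [i] and stay at distance at least
       |zhat_i| from [zhat]. *)
    near=> j; apply/negP => iG.
    have := le_coord_enorm (zeta j.+1 - zhat) (rshift n i).
    rewrite colB_coord (GSNewton_step_vanish (newton j) iG) sub0r normrN leNgt.
    rewrite -[enorm _]mul1r; move/negP; apply; near: j; exact: small.
  have gi0 : 0 < `|grad g zhat (rshift n i) 0|.
    rewrite normr_gt0; case: stat => _ yE _; have := compl i.
    by rewrite yE [dsubmx _ _ _]mxE zi add0r mxE oppr_eq0 mxE.
  near=> j; apply/negPn/negP => iG.
  have [] := GSNewton_step_free affine lipg alpha0 (newton j) zi iG.
    rewrite leNgt => /negP; apply; near: j; exact: small.
  (* For a rejected step, each of the two vanishing terms is given half of the positive left
     side. *)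
  have : 1 * a j.+1 < alpha * `|grad g zhat (rshift n i) 0| / 2.
    by near: j; apply: small => //; rewrite divr_gt0// mulr_gt0.
  have : (1 + alpha * ell_g) * a j < alpha * `|grad g zhat (rshift n i) 0| / 2.
    by near: j; apply: small => //; rewrite divr_gt0// mulr_gt0.
  rewrite /a; lra.
(* The second entry of the maximum in [eta]; its root bounds the ratio of the half point's distance
   to that of the iterate. *)
set K := (1 + alpha * ell_g) ^+ 2 + (1 + eta1) ^+ 2.
have K0 : 0 <= K by rewrite addr_ge0 ?sqr_ge0.
have halfE j : Gamma g lambda alpha (zeta j) = zero_set zhat ->
    enorm (half_point g lambda alpha t (zeta j) - zhat) <= Num.sqrt K * a j.
  move=> /(half_point_le lipg alpha0 t0 gradx0 gradu0) h.
  rewrite -ler_sqr ?nnegrE ?mulr_ge0 ?sqrtr_ge0 ?enorm_ge0//.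
  by rewrite exprMn [Num.sqrt K ^+ 2]sqr_sqrtr.
have [N _ hN] : \forall j \near \oo,
    enorm (zeta j.+1 - zhat) <= eta * enorm (zeta j - zhat) ^+ 2.
  near=> j.
  have GE : Gamma g lambda alpha (zeta j) = zero_set zhat by near: j.
  have rle := halfE j GE.
  (* Both smallness conditions on the half point are imposed on its bound [Num.sqrt K * a j], which
     tends to 0. *)
  have Lr : L_g * (Num.sqrt K * a j) < sigma_g / 8.
    rewrite mulrA; near: j; apply: small => //.
    by rewrite divr_gt0.
  have rsmall : forall i, zhat (rshift n i) 0 != 0 ->
      Num.sqrt K * a j < `|zhat (rshift n i) 0|.
    near: j; apply: filter_forall => i.
    have [zi|zi] := eqVneq (zhat (rshift n i) 0) 0; first by near=> j.
    by near=> j => _; near: j; apply: small => //; rewrite normr_gt0.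
  apply: (le_trans (GSNewton_step_le dg dgradg sigma0 cg liph gradx0 gradu0
    (newton j) GE _ _)).
  - by apply: le_trans (ltW Lr); exact: ler_wpM2l.
  - by move=> i /rsmall; exact: le_lt_trans.
  have h := half_point_le lipg alpha0 t0 gradx0 gradu0 GE.
  rewrite /eta -[leRHS]mulrA; apply: ler_wpM2l; first by rewrite divr_ge0// ltW.
  by apply: le_trans h _; rewrite ler_wpM2r ?sqr_ge0// le_max lexx orbT.
by exists N => j; exact: hN.
Unshelve. all: by end_near. Qed.
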